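(* Let $f:\mathbb{R}^n\to\mathbb{R}$ be convex and twice continuously differentiable, let $A\in\mathbb{R}^{m\times n}$ have full row rank $m$, let $b\in\mathbb{R}^m$, $0\le s\le n$, $\tfrac12\le\gamma<1$, $t_0\ge 0$, $\sigma_1>0$, $\sigma_2>0$, and assume that the problem $\min\{f(x): Ax=b,\ x_i\ge 0,\ i=1,\dots,s\}$ has an optimal solution. Let $(x^0,y^0)\in\mathbb{R}^n_{s++}\times\mathbb{R}^m$ and let $[t_0,\alpha)$ be the maximal existence interval of the solution $(x(t),y(t))$ of the ODE system $$\frac{dx}{dt}=-U(x)^2\left[\nabla f(x)+A^Ty+\sigma_1A^T(Ax-b)\right],\quad x(t_0)=x^0,\qquad \frac{dy}{dt}=\sigma_2(Ax-b),\quad y(t_0)=y^0 .$$ Then $\alpha=+\infty$.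
   Context: Notation: $\mathbb{R}^n_{s++}=\{x\in\mathbb{R}^n: x_i>0,\ 1\le i\le s\}$. For $x\in\mathbb{R}^n_{s++}$, $U(x)=\mathrm{diag}(u)\in\mathbb{R}^{n\times n}$ with $u_i=x_i^{\gamma}$ for $1\le i\le s$ and $u_i=1$ for $s+1\le i\le n$. The ODE system is considered on $\mathbb{R}^n_{s++}\times\mathbb{R}^m$, i.e. a solution takes values $(x(t),y(t))\in\mathbb{R}^n_{s++}\times\mathbb{R}^m$; the maximal existence interval $[t_0,\alpha)$, with $t_0<\alpha\le+\infty$, is the largest forward interval on which such a solution exists. *)

(* Defs.v *)
From HB Require Import structures.
From mathcomp Require Import all_boot all_order all_algebra.
From mathcomp Require Import all_classical all_reals all_analysis.

Set Implicit Arguments.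
Unset Strict Implicit.
Unset Printing Implicit Defensive.

Import Order.TTheory GRing.Theory Num.Theory.
Import numFieldNormedType.Exports.

Local Open Scope classical_set_scope.
Local Open Scope ring_scope.

(* Vectors of R^n are columns; the sign-constrained indices 1..s are the i : 'I_n
   with i < s. *)

Definition gradient (R : realType) (n : nat) (f : 'cV[R]_n -> R)
    (x : 'cV[R]_n) : 'cV[R]_n :=
  \col_i 'D_(delta_mx i 0) f x.

Definition hessian (R : realType) (n : nat) (f : 'cV[R]_n -> R)
    (x : 'cV[R]_n) : 'M[R]_n :=
  \matrix_(i, j) 'D_(delta_mx j 0) (fun z => gradient f z i 0) x.

(* Differentiability is in the sense of Frechet; the Hessian is the Jacobian
   matrix of the gradient. *)
Definition twice_continuously_differentiable (R : realType) (n : nat)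
    (f : 'cV[R]_n -> R) : Prop :=
  [/\ forall x, differentiable f x,
      forall x, differentiable (gradient f) x
    & continuous (hessian f)].

Definition convex_on_space (R : realType) (n : nat) (f : 'cV[R]_n -> R) : Prop :=
  @convex_function R 'cV[R]_n setT f.

Definition positive_part_space (R : realType) (n s : nat) : set 'cV[R]_n :=
  [set x | forall i : 'I_n, (i < s)%N -> 0 < x i 0].

Definition feasible_set (R : realType) (m n s : nat) (A : 'M[R]_(m, n))
    (b : 'cV[R]_m) : set 'cV[R]_n :=
  [set x | A *m x = b /\ forall i : 'I_n, (i < s)%N -> 0 <= x i 0].

Definition is_minimizer (R : realType) (T : Type) (f : T -> R) (S : set T)
    (x : T) : Prop :=
  S x /\ forall z, S z -> f x <= f z.

Definition scaling_mx (R : realType) (n s : nat) (gamma : R) (x : 'cV[R]_n) :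
    'M[R]_n :=
  diag_mx (\row_(i < n) if (i < s)%N then x i 0 `^ gamma else 1).

Definition ode_field (R : realType) (m n s : nat) (gamma sigma1 sigma2 : R)
    (f : 'cV[R]_n -> R) (A : 'M[R]_(m, n)) (b : 'cV[R]_m)
    (z : 'cV[R]_n * 'cV[R]_m) : 'cV[R]_n * 'cV[R]_m :=
  let: (x, y) := z in
  (- (scaling_mx s gamma x ^+ 2
        *m (gradient f x + A^T *m y + sigma1 *: (A^T *m (A *m x - b)))),
   sigma2 *: (A *m x - b)).

(* z solves z' = F(z), z(t0) = z0 on [t0, alpha[ with values in Omega; at the
   left endpoint t0 the derivative is the right derivative. *)
Definition is_ivp_solution (R : realType) (V : normedModType R) (Omega : set V)
    (F : V -> V) (t0 : R) (z0 : V) (alpha : \bar R) (z : R -> V) : Prop :=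
  [/\ (t0%:E < alpha)%E,
      z t0 = z0,
      forall t : R, t0 <= t -> (t%:E < alpha)%E -> Omega (z t),
      forall t : R, t0 < t -> (t%:E < alpha)%E -> is_derive t 1 z (F (z t))
    & h^-1 *: (z (t0 + h) - z t0) @[h --> 0^'+] --> F (z t0)].

(* [t0, alpha[ is the largest forward interval carrying a solution, and z is a
   solution on it. *)
Definition is_maximal_ivp_solution (R : realType) (V : normedModType R)
    (Omega : set V) (F : V -> V) (t0 : R) (z0 : V) (alpha : \bar R)
    (z : R -> V) : Prop :=
  is_ivp_solution Omega F t0 z0 alpha z /\
  forall (beta : \bar R) (w : R -> V),
    is_ivp_solution Omega F t0 z0 beta w -> (beta <= alpha)%E.

(* Main.v *)
Require Import Defs.
From HB Require Import structures.
From mathcomp Require Import all_boot all_order all_algebra.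
From mathcomp Require Import all_classical all_reals all_analysis.
From mathcomp Require Import ring lra.

Set Implicit Arguments.
Unset Strict Implicit.
Unset Printing Implicit Defensive.

Import Order.TTheory GRing.Theory Num.Theory.
Import numFieldNormedType.Exports.

Local Open Scope classical_set_scope.
Local Open Scope ring_scope.

(* Suppose the maximal interval [t0, r[ is bounded. Let xs be a minimizer and mu
   a multiplier given by Farkas' lemma, so that (-mu^T) plays the role of the
   optimal dual variable. The function
     sum_(i < s) D_i(x_i) + sum_(i >= s) (x_i - xs_i)^2 / 2
       + |y + mu^T|^2 / (2 sigma2),   D_i'(u) = (u - xs_i) u^(-2 gamma),
   is nonincreasing along the solution by monotonicity of the gradient and the
   KKT inequality; since gamma < 1 each D_i has bounded sublevel sets, so (x, y)
   stays bounded. Then (ln x_i)' is bounded because 2 gamma >= 1, so for i < s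
   the x_i stay away from 0 on [t0, r[. On a compact box inside the domain the
   field is Lipschitz, hence Picard-Lindelof gives local solutions on a time
   interval of length delta independent of the starting point; restarting
   from a time closer to r than delta extends the solution beyond r. *)

(** * Farkas' lemma and multipliers *)

(* Bartl's induction: eliminate one inequality a by projecting along a vector e
   violating the conclusion for the remaining inequalities. *)
Lemma farkas (F : realFieldType) (m n : nat) (A : 'M[F]_(m, n))
    (s : seq 'rV[F]_n) (c : 'rV[F]_n) :
  (forall d : 'cV_n, A *m d = 0 -> (forall a, a \in s -> 0 <= (a *m d) 0 0) ->
     0 <= (c *m d) 0 0) ->
  exists mu : 'rV_m, forall d : 'cV_n,
    (forall a, a \in s -> 0 <= (a *m d) 0 0) ->
    (mu *m A *m d) 0 0 <= (c *m d) 0 0.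
Proof.
move: {2}(size s) (erefl (size s)) => k; elim: k s c => [|k IHk] s c.
  move=> /eqP; rewrite size_eq0 => /eqP -> H.
  (* With no inequality left, the hypothesis applies to a kernel vector of [A] and to its opposite,
     so [c] vanishes on the kernel and lies in the row space of [A]. *)
  have : (c <= A)%MS.
    rewrite submxE; apply/eqP/rowP => j.
    have Kj : A *m col j (cokermx A) = 0 by rewrite colE mulmxA mulmx_coker mul0mx.
    have := H _ Kj (fun _ => ltac:(by [])).
    have := H (- col j (cokermx A)); rewrite !mulmxN Kj oppr0.
    move=> /(_ erefl (fun _ => ltac:(by []))).
    rewrite (_ : c *m col j _ = col j (c *m cokermx A)); last by rewrite !colE mulmxA.
    rewrite !mxE oppr_ge0 => l0 g0.
    by apply/eqP; rewrite eq_le l0 g0.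
  by move=> /submxP[mu ->]; exists mu => d _.
case: s => // a s [sk] H.
have [Hs|] := pselect (forall d : 'cV_n, A *m d = 0 ->
    (forall b, b \in s -> 0 <= (b *m d) 0 0) -> 0 <= (c *m d) 0 0).
  have [mu Hmu] := IHk s c sk Hs.
  exists mu => d sd; apply: Hmu => b bs; apply: sd.
  by rewrite inE bs orbT.
move=> /existsNP[e0 /not_implyP[Ae0 /not_implyP[se0 /negP]]].
rewrite -ltNge => ce0.
have ae0 : (a *m e0) 0 0 < 0.
  rewrite ltNge; apply/negP => ae; move: ce0; apply/negP; rewrite -leNgt.
  by apply: H => // b; rewrite inE => /predU1P[->|/se0].
(* The scaling gives [a] the value -1 at [e], so [d] plus [a *m d] times [e] is the projection of
   [d] along [e] onto the kernel of [a]; [pr b] below is [b] composed with it. *)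
pose e := (- (a *m e0) 0 0)^-1 *: e0.
have t0 : 0 < (- (a *m e0) 0 0)^-1 by rewrite invr_gt0 oppr_gt0.
have ae : (a *m e) 0 0 = -1.
  by rewrite /e -scalemxAr mxE invrN mulNr mulVf // lt_eqF.
have Ae : A *m e = 0 by rewrite /e -scalemxAr Ae0 scaler0.
have se b : b \in s -> 0 <= (b *m e) 0 0.
  by move=> /se0 h; rewrite /e -scalemxAr mxE mulr_ge0 // ltW.
have ce : (c *m e) 0 0 < 0 by rewrite /e -scalemxAr mxE pmulr_rlt0.
pose pr (b : 'rV[F]_n) := b + (b *m e) 0 0 *: a.
have prE b (d : 'cV_n) :
    (pr b *m d) 0 0 = (b *m d) 0 0 + (b *m e) 0 0 * (a *m d) 0 0.
  by rewrite /pr mulmxDl -scalemxAl !mxE.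
have [||mu Hmu] := IHk (map pr s) (pr c); first by rewrite size_map.
  move=> d Ad sd; pose d' := d + (a *m d) 0 0 *: e.
  have d'E (b : 'rV_n) : (b *m d') 0 0 = (pr b *m d) 0 0.
    by rewrite prE /d' mulmxDr -scalemxAr !mxE; congr (_ + _); rewrite mulrC.
  rewrite -d'E; apply: H.
    by rewrite /d' mulmxDr -scalemxAr Ae Ad scaler0 addr0.
  move=> b; rewrite inE => /predU1P[->|bs].
    by rewrite d'E prE ae mulN1r subrr.
  by rewrite d'E; apply: sd; exact: map_f.
(* The multiplier of the projected problem still works: [pr c] is at most [c] at [d], since [c *m e]
   is negative and [a *m d] nonnegative. *)
exists mu => d sd.
have ad : 0 <= (a *m d) 0 0 by apply: sd; rewrite mem_head.
apply: (le_trans (Hmu d _)).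
  move=> _ /mapP[b bs ->]; rewrite prE addr_ge0 ?mulr_ge0 //; last exact: se.
  by apply: sd; rewrite inE bs orbT.
by rewrite prE gerDl mulr_le0_ge0 // ltW.
Qed.

(** * Directional derivatives of convex functions *)

Lemma deriveE_gradient (R : realType) (n : nat) (f : 'cV[R]_n -> R)
    (x d : 'cV[R]_n) :
  differentiable f x -> 'D_d f x = \sum_i gradient f x i 0 * d i 0.
Proof.
move=> fx; rewrite deriveE // {1}(matrix_sum_delta d) linear_sum.
apply: eq_bigr => i _; rewrite big_ord1 linearZ /= mxE deriveE //.
by rewrite mulrC.
Qed.

(** The limit defining the derivative is also the limit from the right, so small positive steps
    suffice; convexity and feasible directions provide only these. *)
Lemma derive_ge_quotient (R : realType) (V : normedModType R) (f : V -> R)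
    (x v : V) (C e : R) :
  derivable f x v -> 0 < e ->
  (forall h, 0 < h < e -> h * C <= f (h *: v + x) - f x) -> C <= 'D_v f x.
Proof.
move=> fx e0 H.
have Hc := cvg_dnbhs_at_right fx; rewrite /derive -(cvg_lim _ Hc) //.
apply: limr_ge; first by apply/cvg_ex; exists ('D_v f x).
near=> h.
have h0 : 0 < h by near: h; exact: nbhs_right_gt.
rewrite [leRHS](_ : _ = h^-1 * (f (h *: v + x) - f x)) // ler_pdivlMl // H // h0.
by near: h; exact: nbhs_right_lt.
Unshelve. all: by end_near. Qed.

(** Convexity bounds the increment of [f] over a step [h < 1] by [h * (f z - f x)]. The quotient
    bound is a lower bound, hence its use on [- f]. *)
Lemma convex_derive_le (R : realType) (n : nat) (f : 'cV[R]_n -> R)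
    (x z : 'cV[R]_n) :
  convex_on_space f -> differentiable f x -> 'D_(z - x) f x <= f z - f x.
Proof.
move=> fc fx.
rewrite -[leLHS]opprK lerNl -deriveN; last exact: diff_derivable.
apply: (@derive_ge_quotient _ _ _ _ _ _ 1) => //.
  by apply: derivableN; exact: diff_derivable.
move=> h /andP[h0 h1]; have h01 : (0 <= h <= 1) by rewrite !ltW.
pose t : {i01 R} := Itv01 (andP h01).1 (andP h01).2.
have := fc t z x; rewrite !inE => /(_ I I); rewrite convRE /conv /= /unstable.onem.
rewrite (_ : h *: z + _ = h *: (z - x) + x); last first.
  by rewrite scalerBl scale1r scalerBr addrA addrAC.
by rewrite -[(- f) _]/(- f _) -[(- f) x]/(- f x) => fh; lra.
Qed.

(** Sum of the two gradient inequalities, from [x] towards [z] and from [z] towards [x]. *)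
Lemma convex_gradient_monotone (R : realType) (n : nat) (f : 'cV[R]_n -> R)
    (x z : 'cV[R]_n) :
  convex_on_space f -> differentiable f x -> differentiable f z ->
  'D_(z - x) f x <= 'D_(z - x) f z.
Proof.
move=> fc fx fz; have h1 := convex_derive_le z fc fx.
have := convex_derive_le x fc fz.
rewrite -[x - z]opprB deriveE // linearN -deriveE // => h2; lra.
Qed.

(** Farkas' lemma for the coordinate forms of the active constraints. A direction in the kernel of
    [A] that decreases no active coordinate is feasible for short steps, so by minimality [f] has a
    nonnegative derivative along it. The conclusion keeps the sign conditions on [d] in place of
    multipliers for the active constraints. *)
Lemma kkt_multiplier (R : realType) (m n s : nat) (f : 'cV[R]_n -> R)
    (A : 'M[R]_(m, n)) (b : 'cV[R]_m) (xs : 'cV[R]_n) :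
  differentiable f xs -> is_minimizer f (feasible_set s A b) xs ->
  exists mu : 'rV[R]_m, forall d : 'cV[R]_n,
    (forall i : 'I_n, (i < s)%N -> xs i 0 = 0 -> 0 <= d i 0) ->
    (mu *m A *m d) 0 0 <= 'D_d f xs.
Proof.
move=> fx [[Axs xs_ge0] xs_min].
pose act := [seq (delta_mx 0 i : 'rV[R]_n) | i : 'I_n <- enum 'I_n &
               (i < s)%N && (xs i 0 == 0)].
have actE (d : 'cV_n) : (forall a, a \in act -> 0 <= (a *m d) 0 0) <->
    (forall i : 'I_n, (i < s)%N -> xs i 0 = 0 -> 0 <= d i 0).
  split=> H.
    move=> i si xi; have := H (delta_mx 0 i).
    rewrite -rowE mxE; apply; apply/mapP; exists i => //.
    by rewrite mem_filter si xi eqxx mem_enum.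
  move=> a /mapP[i + ->]; rewrite mem_filter => /andP[/andP[si /eqP xi] _].
  by rewrite -rowE mxE H.
have cE d : (\row_i gradient f xs i 0 *m d) 0 0 = 'D_d f xs.
  by rewrite deriveE_gradient // mxE; apply: eq_bigr => i _; rewrite mxE.
have [|mu Hmu] := @farkas _ _ _ A act (\row_i gradient f xs i 0); last first.
  by exists mu => d Hd; rewrite -cE; apply: Hmu; apply/actE.
move=> d Ad /actE Hd; rewrite cE.
have [e e0 He] : exists2 e, 0 < e & forall h, 0 < h < e ->
    forall i : 'I_n, (i < s)%N -> 0 <= h * d i 0 + xs i 0.
  (* An inactive coordinate stays nonnegative for steps below its value over [|d_i|]; the added 1
     keeps the denominator positive. *)
  pose q i := if 0 < xs i 0 then xs i 0 / (`|d i 0| + 1) else 1.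
  exists (\big[Num.min/1]_i q i).
    elim/big_ind: _ => [|u v u0 v0|i _]; first exact: ltr01.
      by rewrite lt_min u0.
    by rewrite /q; case: ifPn => // xi; rewrite divr_gt0 // ltr_wpDl.
  move=> h /andP[h0 hq] i si.
  have := xs_ge0 i si; rewrite le_eqVlt => /predU1P[xi|xi].
    by rewrite -xi addr0 mulr_ge0 ?Hd // ltW.
  have : h < q i by apply: (lt_le_trans hq); exact: bigmin_le.
  rewrite /q xi ltr_pdivlMr ?ltr_wpDl // => hxi.
  have : - `|d i 0| <= d i 0 by rewrite lerNl -normrN ler_norm.
  by move: (normr_ge0 (d i 0)) hxi h0; nra.
apply: (derive_ge_quotient _ e0); first exact: diff_derivable.
move=> h he; rewrite mulr0 subr_ge0; apply: xs_min; split.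
  by rewrite mulmxDr -scalemxAr Ad scaler0 add0r.
by move=> i si; rewrite !mxE; exact: He.
Qed.

(** * The Picard-Lindelof theorem *)

Lemma continuous_antiderivative (R : realType) (g : R -> R) (a b : R) :
  continuous g ->
  exists G : R -> R, forall t, a < t < b -> is_derive t 1 G (g t).
Proof.
move=> gc.
exists (fun t => \int[@lebesgue_measure R]_(s in `[a, t]) g s)%R => t /andP[at_ tb].
have gi : (@lebesgue_measure R).-integrable `[a, b] (EFin \o g).
  apply: continuous_compact_integrable; first exact: segment_compact.
  exact: continuous_subspaceT.
have [d1 d2] := continuous_FTC1_closed tb gi at_ (gc t).
by split => //; rewrite -derive1E.
Qed.

Lemma mean_value_bound (R : realType) (G g : R -> R) (a b M : R) :
  a <= b -> (forall t, a <= t <= b -> is_derive t 1 G (g t)) ->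
  (forall t, a <= t <= b -> `|g t| <= M) ->
  `|G b - G a| <= M * (b - a).
Proof.
move=> ab dG gM.
have [||c cab ->] := MVT_segment ab (f := G) (df := g).
- by move=> t; rewrite in_itv /= => /andP[? ?]; apply: dG; rewrite !ltW.
- apply: (@derivable_within_continuous _ _ G `[a, b]) => t; rewrite in_itv /= => tab.
  by have [] := dG t tab.
- have ba : 0 <= b - a by rewrite subr_ge0.
  by rewrite normrM (ger0_norm ba) ler_wpM2r // gM //; rewrite in_itv in cab.
Qed.

(** The intervals around [u k] whose radius is the sum of the bounds on all later steps are nested;
    the supremum of their left endpoints lies in each of them. *)
Lemma geometric_steps_cvg (R : realType) (u : nat -> R) (C : R) :
  0 <= C -> (forall k, `|u k.+1 - u k| <= C / 2 ^+ k) ->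
  exists l, forall k, `|l - u k| <= 2 * C / 2 ^+ k.
Proof.
move=> C0 Hu.
pose e k := 2 * C / 2 ^+ k.
have e_ge0 k : 0 <= e k by rewrite !mulr_ge0 ?invr_ge0 ?exprn_ge0.
have eS k : e k = e k.+1 + C / 2 ^+ k.
  rewrite /e exprS; have : (2 : R) ^+ k != 0 by rewrite expf_neq0.
  by move=> ?; field.
have mono k j : u k - e k <= u (k + j)%N - e (k + j)%N /\
                u (k + j)%N + e (k + j)%N <= u k + e k.
  elim: j => [|j [IH1 IH2]]; first by rewrite addn0.
  rewrite addnS; have := Hu (k + j)%N; rewrite ler_norml => /andP[h1 h2].
  by have := eS (k + j)%N => h3; split; lra.
have cross k j : u j - e j <= u k + e k.
  have [h1 _] := mono j k; have [_ h2] := mono k j.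
  rewrite addnC in h2; have := e_ge0 (j + k)%N; lra.
pose S := range (fun k => u k - e k).
have S_ub k : ubound S (u k + e k) by move=> _ [j _ <-]; exact: cross.
exists (sup S) => k; rewrite -/(e k) ler_norml; apply/andP; split.
  suff : u k - e k <= sup S by lra.
  by apply: ub_le_sup; [exists (u 0%N + e 0%N) | exists k].
suff : sup S <= u k + e k by lra.
by apply: ge_sup; [exists (u 0%N - e 0%N); exists 0%N | exact: S_ub].
Qed.

(** A consequence of the Archimedean property, used to pass to the limit in estimates along the
    Picard iterates. *)
Lemma le_geometric_le0 (R : realType) (x C : R) :
  (forall k, x <= C / 2 ^+ k) -> x <= 0.
Proof.
move=> H; rewrite leNgt; apply/negP => x0.
have C0 : 0 <= C / x.
  by have := H 0%N; rewrite expr0 divr1 => xC; rewrite divr_ge0 ?ltW // (lt_le_trans x0).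
have := archi_boundP C0; set k := Num.bound _ => Ck.
have k2 : (k%:R : R) <= 2 ^+ k by rewrite -natrX ler_nat ltnW // ltn_expl.
have p0 : (0 : R) < 2 ^+ k by rewrite exprn_gt0.
have := H k; rewrite ler_pdivlMr //; move: Ck; rewrite ltr_pdivrMr // => Ck.
have : k%:R * x <= 2 ^+ k * x by rewrite ler_pM2r.
lra.
Qed.

(** For positive [d], the nearest point of [[0, d]]: composing with it extends to the whole line
    what is controlled only on that interval. *)
Definition clamp (R : realType) (d t : R) :=
  if t <= 0 then 0 else if t <= d then t else d.

Lemma clamp_itv (R : realType) (d t : R) : 0 < d -> 0 <= clamp d t <= d.
Proof.
by move=> d0; rewrite /clamp; case: (leP t 0) => ?; case: (leP t d) => ?; lra.
Qed.

Lemma clampE (R : realType) (d t : R) : 0 <= t <= d -> clamp d t = t.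
Proof.
by rewrite /clamp; case: (leP t 0) => ?; case: (leP t d) => ? ?; lra.
Qed.

Lemma clamp_lip (R : realType) (d s t : R) :
  0 < d -> `|clamp d s - clamp d t| <= `|s - t|.
Proof.
move=> d0; wlog st : s t / s <= t.
  move=> H; have [|/ltW] := leP s t; first exact: H.
  by rewrite distrC (distrC s); exact: H.
have ts0 : 0 <= t - s by rewrite subr_ge0.
rewrite distrC (distrC s) (ger0_norm ts0) ler_norml /clamp.
by case: (leP t 0) => ?; case: (leP t d) => ?;
   case: (leP s 0) => ?; case: (leP s d) => ?; lra.
Qed.

Section picard.
Variables (R : realType) (T : Type) (F : (T -> R) -> T -> R) (p : T -> R).
Variables (r M L delta : R).
Hypotheses (delta_gt0 : 0 < delta) (M_ge0 : 0 <= M) (L_ge0 : 0 <= L).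
Hypotheses (Mdelta : M * delta <= r) (Ldelta : L * delta <= 2^-1).

Let near_p (u : T -> R) := forall i, `|u i - p i| <= r.

Hypothesis F_bounded : forall u, near_p u -> forall i, `|F u i| <= M.
Hypothesis F_lipschitz : forall u v d, near_p u -> near_p v -> 0 <= d ->
  (forall j, `|u j - v j| <= d) -> forall i, `|F u i - F v i| <= L * d.

(** The class that the Picard operator preserves: since [M * delta <= r], its members stay in the
    box where [F] is controlled. *)
Let admissible (z : T -> R -> R) :=
  (forall i, z i 0 = p i) /\
  (forall i s t, 0 <= s <= delta -> 0 <= t <= delta ->
     `|z i s - z i t| <= M * `|s - t|).

Let admissible_near z t : admissible z -> 0 <= t <= delta -> near_p (z^~ t).
Proof.
move=> [z0 zl] t01 i; rewrite -z0 (le_trans _ Mdelta) //.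
apply: (le_trans (zl _ _ _ t01 _)); first by rewrite lexx ltW.
have /andP[t0 td] := t01.
by rewrite subr0 ger0_norm // ler_wpM2l.
Qed.

(** The Picard operator: start at [p] and integrate [F] along [z]. Admissibility is a premise under
    the existential, so that choice yields an operator on all functions, ready for iteration. *)
Let picard_step z : exists z', admissible z -> admissible z' /\
  forall i t, 0 <= t <= delta -> is_derive t 1 (z' i) (F (z^~ t) i).
Proof.
have [az|naz] := pselect (admissible z); last by exists z.
have near_clamp t : near_p (z^~ (clamp delta t)) by apply: admissible_near => //; exact: clamp_itv.
pose g i t := F (z^~ (clamp delta t)) i.
have g_cont i : continuous (g i).
  move=> t; apply/cvgrPdist_le => e e0.
  have LM0 : 0 < L * M + 1 by rewrite ltr_wpDl // mulr_ge0.
  near=> s.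
  apply: (@le_trans _ _ (L * (M * `|t - s|))).
    apply: F_lipschitz => // [|j]; first by rewrite mulr_ge0.
    apply: (le_trans (az.2 _ _ _ _ _)); rewrite ?clamp_itv //.
    by rewrite ler_wpM2l // clamp_lip.
  have : `|t - s| < e / (L * M + 1).
    by near: s; apply: cvgr_dist_lt; [exact: cvg_id | rewrite divr_gt0].
  rewrite ltr_pdivlMr // mulrA => h.
  have := normr_ge0 (t - s); move: h; set a := `|_|; set c := L * M => h a0; lra.
(* The margin of 1 on each side makes the derivatives at 0 and [delta] two-sided. *)
have [G dG] := choice (fun i =>
  @continuous_antiderivative R (g i) (-1) (delta + 1) (g_cont i)).
exists (fun i t => p i + (G i t - G i 0)) => _.
have dz' i t : 0 <= t <= delta ->
    is_derive t 1 (fun t => p i + (G i t - G i 0)) (F (z^~ t) i).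
  move=> t01; have dGt : is_derive t 1 (G i) (g i t) by apply: dG; lra.
  rewrite -[in z^~ t](clampE t01) -[F _ _]/(g i t).
  have -> : (fun t => p i + (G i t - G i 0)) = cst (p i) + (G i - cst (G i 0)) by [].
  by apply: is_derive_eq; rewrite subr0 add0r.
split => //; split => [i|i s t s01 t01]; first by rewrite subrr addr0.
wlog st : s t s01 t01 / s <= t.
  move=> H; have [|/ltW] := leP s t; first exact: H.
  by rewrite distrC (distrC s); exact: H.
rewrite distrC (distrC s) (ger0_norm (_ : 0 <= t - s)) ?subr_ge0 //.
apply: (@mean_value_bound _ (fun t => p i + (G i t - G i 0))
  (fun t => F (z^~ t) i)) => // q qst.
  by apply: dz'; lra.
by apply: F_bounded; apply: admissible_near => //; lra.
Unshelve. all: by end_near. Qed.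

(** The operator contracts by a factor 1/2 because [L * delta <= 1/2], so the iterates of the
    constant [p] converge geometrically. [T] indexes the coordinates, and all bounds are uniform in
    it. *)
Lemma picard_lindelof : exists w : T -> R -> R,
  [/\ forall i, w i 0 = p i,
      forall t, 0 <= t <= delta -> forall i, `|w i t - p i| <= r
    & forall i t, 0 <= t <= delta -> is_derive t 1 (w i) (F (w^~ t) i)].
Proof.
have [phi phiP] := choice picard_step.
pose zs k := iter k phi (fun i _ => p i).
have zs_adm k : admissible (zs k).
  elim: k => [|k IHk]; last by have [] := phiP _ IHk.
  by split => // i s t _ _; rewrite subrr normr0 mulr_ge0.
have dzs k i t : 0 <= t <= delta -> is_derive t 1 (zs k.+1 i) (F ((zs k)^~ t) i).
  by have [_] := phiP _ (zs_adm k); exact.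
(* both functions start at p, so the distance of the derivatives controls theirs *)
have contract z1 z2 u1 u2 d : admissible z1 -> admissible z2 ->
    admissible u1 -> admissible u2 -> 0 <= d ->
    (forall i t, 0 <= t <= delta -> is_derive t 1 (u1 i) (F (z1^~ t) i)) ->
    (forall i t, 0 <= t <= delta -> is_derive t 1 (u2 i) (F (z2^~ t) i)) ->
    (forall i t, 0 <= t <= delta -> `|z1 i t - z2 i t| <= d) ->
    forall i t, 0 <= t <= delta -> `|u1 i t - u2 i t| <= d / 2.
  move=> az1 az2 au1 au2 d0 du1 du2 z12 i t t01; have /andP[t0 td] := t01.
  have -> : u1 i t - u2 i t = (u1 i t - u2 i t) - (u1 i 0 - u2 i 0).
    by rewrite au1.1 au2.1 subrr subr0.
  apply: (@le_trans _ _ (L * d * (t - 0))).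
    apply: (@mean_value_bound _ (u1 i - u2 i)
      (fun t => F (z1^~ t) i - F (z2^~ t) i)) => // q q0t.
      have q01 : 0 <= q <= delta by lra.
      by have := du1 i q q01; have := du2 i q q01 => ? ?; apply: is_deriveB.
    have q01 : 0 <= q <= delta by lra.
    by apply: F_lipschitz => // [||j]; [exact: admissible_near | exact: admissible_near | exact: z12].
  have h : L * t <= 2^-1 by apply: le_trans Ldelta; rewrite ler_wpM2l.
  by rewrite subr0 mulrAC (mulrC d) ler_wpM2r.
have C0 : 0 <= M * delta by rewrite mulr_ge0 // ltW.
(* The first iterate stays within [M * delta] of [p]; [contract] halves every later step. *)
have zs_dist k i t : 0 <= t <= delta ->
    `|zs k.+1 i t - zs k i t| <= M * delta / 2 ^+ k.
  elim: k i t => [|k IHk] i t t01.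
    rewrite expr0 divr1 -[zs 0%N i t]/(p i) -[in X in _ - X](zs_adm 1%N).1.
    have /andP[t0 td] := t01.
    apply: (le_trans ((zs_adm 1%N).2 _ _ _ t01 _)); first by rewrite lexx ltW.
    by rewrite subr0 ger0_norm // ler_wpM2l.
  rewrite exprSr invfM mulrA.
  apply: (@contract (zs k.+1) (zs k)) => //.
  by rewrite divr_ge0 // exprn_ge0.
have /choice[zl zlP] (it : T * R) : exists l, forall k,
    `|l - zs k it.1 (clamp delta it.2)| <= 2 * (M * delta) / 2 ^+ k.
  by apply: geometric_steps_cvg => // k; apply: zs_dist; exact: clamp_itv.
pose z i t := zl (i, t).
have zP k i t : 0 <= t <= delta -> `|z i t - zs k i t| <= 2 * (M * delta) / 2 ^+ k.
  by move=> t01; have := zlP (i, t) k; rewrite /= clampE.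
have z_adm : admissible z.
  split=> [i|i s t s01 t01].
    apply/eqP; rewrite -subr_eq0 -normr_le0; apply: le_geometric_le0 => k.
    by rewrite -(zs_adm k).1; apply: zP; rewrite lexx ltW.
  rewrite -subr_le0; apply: (@le_geometric_le0 _ _ (4 * (M * delta))) => k.
  have := zP k i s s01; have := zP k i t t01; have := (zs_adm k).2 i s t s01 t01.
  set e := 2 * _ / _ => h1 h2 h3.
  have -> : 4 * (M * delta) / 2 ^+ k = e + e by rewrite /e; lra.
  have -> : z i s - z i t = (z i s - zs k i s) + (zs k i s - zs k i t) - (z i t - zs k i t) by ring.
  have := ler_normB ((z i s - zs k i s) + (zs k i s - zs k i t)) (z i t - zs k i t).
  have := ler_normD (z i s - zs k i s) (zs k i s - zs k i t); lra.
(* The limit [z] is not known to be differentiable, so the solution is [phi z], whose derivative is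
   [F] along [z]; it remains to identify the two on [[0, delta]]. *)
have [w_adm dw] := phiP _ z_adm.
have wz i t : 0 <= t <= delta -> phi z i t = z i t.
  move=> t01; apply/eqP; rewrite -subr_eq0 -normr_le0.
  apply: (@le_geometric_le0 _ _ (2 * (M * delta))) => k.
  have := zP k.+1 i t t01.
  rewrite (_ : _ / 2 ^+ k.+1 = 2 * (M * delta) / 2 ^+ k / 2); last first.
    by rewrite exprSr invfM !mulrA.
  move=> h1.
  have : `|phi z i t - zs k.+1 i t| <= 2 * (M * delta) / 2 ^+ k / 2.
    apply: (@contract z (zs k)) => //; last by move=> j q q01; exact: zP.
    by rewrite divr_ge0 ?exprn_ge0 // mulr_ge0.
  move: h1; set e := 2 * _ / 2 ^+ k => h1 h2.
  have := ler_distD (zs k.+1 i t) (phi z i t) (z i t).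
  rewrite (distrC (zs _ _ _)); lra.
exists (phi z); split => [||i t t01]; first exact: w_adm.1.
  by move=> t t01; exact: admissible_near.
suff -> : (phi z)^~ t = z^~ t by exact: dw.
by apply/funext => j; exact: wz.
Qed.

End picard.

(** * Entropy functions *)

Lemma powR_sqr (R : realType) (u gamma : R) : (u `^ gamma) ^+ 2 = u `^ (2 * gamma).
Proof. by rewrite -powR_mulrn ?powR_ge0 // -powRrM mulrC. Qed.

(* D is the integral of (v - p) v^(-2 gamma), whose form changes at gamma = 1/2. *)
Lemma entropy_function (R : realType) (gamma p : R) :
  2^-1 <= gamma -> gamma < 1 -> 0 <= p ->
  exists D : R -> R,
    [/\ forall u : R, 0 < u -> is_derive u 1 D ((u - p) / (u `^ gamma) ^+ 2),
        forall u : R, 0 < u -> 0 <= D u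
      & forall C, exists K, forall u : R, 0 < u -> D u <= C -> u <= K].
Proof.
move=> + g1 p0; rewrite le_eqVlt => /predU1P[gE|g2].
  have sqE (u : R) : 0 < u -> (u `^ gamma) ^+ 2 = u.
    by move=> u0; rewrite powR_sqr -gE divff ?pnatr_eq0 // powRr1 // ltW.
  move: p0; rewrite le_eqVlt => /predU1P[<-|p0].
    exists id; split => [u u0|u /ltW//|C]; last by exists C.
    by rewrite subr0 sqE // divff ?gt_eqF //; exact: is_derive_id.
  (* The logarithm lies below its tangent at [q]: taking [q = p] gives nonnegativity, and
     [q = 2 * p] gives growth at least like [u / 2]. *)
  have ln_bound (q u : R) : 0 < q -> 0 < u -> ln u <= u / q - 1 + ln q.
    move=> q0 u0; rewrite -lerBlDr -ln_div ?posrE //.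
    have := @le_ln1Dx R (u / q - 1); rewrite (addrC 1) subrK; apply.
    by rewrite ltrBrDl subrr divr_gt0.
  (* With this constant the entropy vanishes at its minimum [u = p]. *)
  pose k := p - p * ln p.
  have kE q u : 0 < q -> 0 < u -> p * ln u <= p * (u / q - 1 + ln q).
    by move=> q0 u0; rewrite ler_pM2l // ln_bound.
  exists (fun u => u - p * ln u - k); split.
  - move=> u u0; have dl := is_derive1_ln u0; rewrite sqE //.
    have -> : (fun u => u - p * ln u - k) = id - p *: (@ln R) - cst k by [].
    apply: is_derive_eq; rewrite subr0 mulrBl divff ?gt_eqF //.
  - move=> u u0; have := kE p u p0 u0; rewrite mulrDr mulrBr mulr1 mulrCA divff ?gt_eqF //.
    by rewrite mulr1 /k; lra.
  - move=> C; exists (2 * (C + k - p + p * ln (2 * p))) => u u0 Du.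
    have := kE (2 * p) u _ u0; rewrite mulr_gt0 // => /(_ erefl).
    have -> : p * (u / (2 * p) - 1 + ln (2 * p)) = u / 2 - p + p * ln (2 * p).
      by field; rewrite gt_eqF.
    by move=> h; move: Du h; set l := p * ln _; set l' := p * ln _; lra.
pose a := 2 - 2 * gamma; pose c := 1 - 2 * gamma.
have a0 : 0 < a by rewrite /a; lra.
have c0 : c < 0 by rewrite /c; lra.
(* As [c] is negative and [p] nonnegative, both terms are nonnegative, so a bound on the sum bounds
   the power with positive exponent [a]. *)
exists (fun u => a^-1 * u `^ a - p / c * u `^ c); split.
- move=> u u0.
  have da := @is_derive1_powR _ a _ u0; have dc := @is_derive1_powR _ c _ u0.
  have -> : (fun u => a^-1 * u `^ a - p / c * u `^ c) =
    a^-1 *: (fun u => u `^ a) - (p / c) *: (fun u => u `^ c) by [].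
  apply: is_derive_eq; rewrite /GRing.scale /= powR_sqr !mulrA mulVf ?gt_eqF //.
  rewrite divfK ?lt_eqF // mul1r mulrBl.
  have -> : a - 1 = 1 - 2 * gamma by rewrite /a; lra.
  have -> : c - 1 = - (2 * gamma) by rewrite /c; lra.
  by rewrite powRN powRB ?(gt_eqF u0) ?implybT // powRr1 // ltW.
- move=> u u0; rewrite subr_ge0.
  apply: (@le_trans _ _ 0); last by rewrite mulr_ge0 ?powR_ge0 // invr_ge0 ltW.
  by rewrite mulr_le0_ge0 ?powR_ge0 // mulr_ge0_le0 // invr_le0 ltW.
(* From [u] to the power [a] being at most [a * C], the inequality [1 + v <= expR v] at
   [v = a * ln u] bounds [ln u]. *)
- move=> C; exists (expR (a * C / a)) => u u0 Du.
  rewrite -[u in u <= _]lnK ?posrE // ler_expR ler_pdivlMr // mulrC.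
  have : u `^ a <= a * C.
    rewrite -ler_pdivrMl //; apply: le_trans Du; rewrite lerDl -mulNr.
    by rewrite mulr_ge0 ?powR_ge0 // oppr_ge0 mulr_ge0_le0 // invr_le0 ltW.
  rewrite /powR gt_eqF // => h.
  have := expR_ge1Dx (a * ln u); lra.
Qed.

(** * Lipschitz continuity of the field *)

Lemma norm_entry_le (R : realType) (m n : nat) (x : 'M[R]_(m, n)) i j :
  `|x i j| <= `|x|.
Proof. by rewrite [leRHS]/Num.norm /= mx_normrE; exact: (le_bigmax _ _ (i, j)). Qed.

(** For the max norm the ball is contained in the transpose of a box of row vectors, and such a box
    is compact as a product of segments. *)
Lemma continuous_bounded_cV (R : realType) (n : nat) (g : 'cV[R]_n -> R) (K : R) :
  continuous g -> exists H, forall x, `|x| <= K -> `|g x| <= H.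
Proof.
move=> gc.
have trc : continuous (fun v : 'rV[R]_n => v^T).
  move=> v A [P Pv PA]; exists (fun i j => P j i).
    by move=> i j; have := Pv j i; rewrite mxE.
  by move=> w Pw; apply: PA => i j; rewrite mxE.
pose box := [set v : 'rV[R]_n | forall i, v ord0 i \in `[- K, K]].
have cbox : compact box.
  by apply: (@rV_compact _ _ (fun=> `[- K, K]%classic)) => _; exact: segment_compact.
have gtc : continuous (fun v : 'rV[R]_n => g v^T).
  by move=> v; apply: continuous_comp; [exact: trc | exact: gc].
have [M [_ HM]] := compact_bounded (continuous_compact (continuous_subspaceT gtc) cbox).
exists (M + 1) => x xK; apply: (HM (M + 1)); first by rewrite ltrDl.
exists x^T; last by rewrite trmxK.
move=> i; rewrite mxE in_itv /= -ler_norml.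
by apply: le_trans xK; exact: norm_entry_le.
Qed.

Lemma norm_cV_le (R : realType) (n : nat) (x : 'cV[R]_n) (C : R) : 0 <= C ->
  (forall i, `|x i 0| <= C) -> `|x| <= C.
Proof.
move=> C0 H; rewrite [leLHS]/Num.norm /= mx_normrE.
by apply: bigmax_le => // -[i j] _; rewrite ord1 /=.
Qed.

(** Boundedness is included to make the class stable under products; one constant serves both
    bounds. *)
Definition bounded_lipschitz (R : realType) (V : normedModType R) (S : set V)
    (g : V -> R) :=
  exists L, [/\ 0 <= L, forall u, S u -> `|g u| <= L
    & forall u v, S u -> S v -> `|g u - g v| <= L * `|u - v|].

Section bounded_lipschitz_theory.
Variables (R : realType) (V : normedModType R) (S : set V).
Implicit Types g h : V -> R.

Lemma bounded_lipschitz_cst (c : R) : bounded_lipschitz S (fun _ => c).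
Proof.
by exists `|c|; split => // u v _ _; rewrite subrr normr0 mulr_ge0.
Qed.

Lemma bounded_lipschitzD g h : bounded_lipschitz S g -> bounded_lipschitz S h ->
  bounded_lipschitz S (fun u => g u + h u).
Proof.
move=> [L [L0 gL gl]] [M [M0 hM hl]]; exists (L + M); split => [|u Su|u v Su Sv].
- exact: addr_ge0.
- by apply: (le_trans (ler_normD _ _)); rewrite lerD ?gL ?hM.
- rewrite opprD addrACA (le_trans (ler_normD _ _)) // mulrDl.
  by rewrite lerD ?gl ?hl.
Qed.

Lemma bounded_lipschitzM g h : bounded_lipschitz S g -> bounded_lipschitz S h ->
  bounded_lipschitz S (fun u => g u * h u).
Proof.
move=> [L [L0 gL gl]] [M [M0 hM hl]]; exists (L * M + L * M).
split => [|u Su|u v Su Sv].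
- by rewrite addr_ge0 // mulr_ge0.
- rewrite normrM (@le_trans _ _ (L * M)) ?ler_pM ?gL ?hM //.
  by rewrite lerDl mulr_ge0.
- have -> : g u * h u - g v * h v = g u * (h u - h v) + (g u - g v) * h v by ring.
  rewrite (le_trans (ler_normD _ _)) // (mulrDl (L * M)) !normrM lerD //.
    by rewrite -mulrA ler_pM ?gL ?hl.
  by rewrite mulrAC ler_pM ?hM ?gl.
Qed.

Lemma bounded_lipschitz_sum (I : finType) (g : I -> V -> R) :
  (forall i, bounded_lipschitz S (g i)) ->
  bounded_lipschitz S (fun u => \sum_i g i u).
Proof.
move=> H; elim: (index_enum I) => [|i s IH].
  have -> : (fun u => \sum_(i <- [::]) g i u) = (fun _ => 0).
    by apply/funext => u; rewrite big_nil.
  exact: bounded_lipschitz_cst.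
have -> : (fun u => \sum_(j <- i :: s) g j u) =
    (fun u => g i u + \sum_(j <- s) g j u).
  by apply/funext => u; rewrite big_cons.
exact: bounded_lipschitzD.
Qed.

Lemma bounded_lipschitz_comp (h dh : R -> R) g (a b M : R) :
  bounded_lipschitz S g -> (forall u, S u -> a <= g u <= b) ->
  (forall t, a <= t <= b -> is_derive t 1 h (dh t)) ->
  (forall t, a <= t <= b -> `|dh t| <= M) ->
  bounded_lipschitz S (fun u => h (g u)).
Proof.
move=> [L [L0 gL gl]] gab dhP dhM.
(* A point of [S] is needed for boundedness: one value of [h] and its Lipschitz constant bound all
   the others. *)
have [Sn0|S0] := pselect (exists u, S u); last first.
  by exists 0; split => // [u Su|u v Su _]; case: S0; exists u.
have [u0 Su0] := Sn0; have ab := gab _ Su0.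
have M0 : 0 <= M by apply: le_trans (dhM _ ab).
have hl x y : a <= x <= b -> a <= y <= b -> `|h x - h y| <= M * `|x - y|.
  wlog xy : x y / x <= y.
    move=> H ax ay; have [|/ltW] := leP x y; first by move=> ?; exact: H.
    by rewrite distrC (distrC x) => ?; exact: H.
  move=> ax ay; have yx0 : 0 <= y - x by rewrite subr_ge0.
  rewrite distrC (distrC x) (ger0_norm yx0).
  apply: (@mean_value_bound _ h dh) => // t txy; [apply: dhP | apply: dhM].
    by apply/andP; split; lra.
  by apply/andP; split; lra.
pose B := `|h (g u0)| + M * (L + L); exists (M * L + B).
have B0 : 0 <= B by rewrite addr_ge0 // mulr_ge0 // addr_ge0.
split => [|u Su|u v Su Sv]; first by rewrite addr_ge0 // mulr_ge0.
  rewrite (@le_trans _ _ B) ?lerDr ?mulr_ge0 // /B -lerBlDl.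
  rewrite (le_trans (lerB_dist _ _)) // (le_trans (hl _ _ (gab _ Su) ab)) //.
  by rewrite ler_wpM2l // (le_trans (ler_normB _ _)) // lerD ?gL.
rewrite (le_trans (hl _ _ (gab _ Su) (gab _ Sv))) // mulrDl -mulrA.
by apply: ler_wpDr; rewrite ?mulr_ge0 // ler_wpM2l // gl.
Qed.

End bounded_lipschitz_theory.

Lemma is_derive_line (R : realType) (V : normedModType R) (g : V -> R) (u d : V)
    (t : R) :
  differentiable g (u + t *: d) ->
  is_derive t 1 (fun t => g (u + t *: d)) ('D_d g (u + t *: d)).
Proof.
move=> dg; have := @diff_derivable _ _ _ g (u + t *: d) d dg; rewrite /derivable /derive /= => H.
have E : (fun h : R => h^-1 *: (g (u + (h *: 1 + t) *: d) - g (u + t *: d))) =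
    (fun h => h^-1 *: (g (h *: d + (u + t *: d)) - g (u + t *: d))).
  apply/funext => h; rewrite scalerDl -scalerA scale1r.
  by rewrite addrCA.
by split; rewrite /derivable /derive /= E.
Qed.

(** The ball is convex, so the mean value bound applies along segments. The partial derivatives are
    bounded on it, and the sum of their bounds is a Lipschitz constant for the max norm. *)
Lemma C1_bounded_lipschitz (R : realType) (n : nat) (g : 'cV[R]_n -> R) (K : R) :
  (forall x, differentiable g x) ->
  (forall j, continuous (fun x => 'D_(delta_mx j 0) g x)) ->
  bounded_lipschitz [set x | `|x| <= K] g.
Proof.
move=> dg cg.
have [B HB] := continuous_bounded_cV K (fun x => differentiable_continuous (dg x)).
have [P HP] := choice (fun j => continuous_bounded_cV K (cg j)).
pose Q := \sum_j `|P j|.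
have Q0 : 0 <= Q by rewrite sumr_ge0.
exists (`|B| + Q); split => [|u /= uK|u v /= uK vK]; first by rewrite addr_ge0.
  by rewrite (le_trans (HB u uK)) // (le_trans (ler_norm _)) // lerDl.
apply: (@le_trans _ _ (Q * `|u - v|)); last first.
  by rewrite ler_wpM2r // lerDr.
have seg t : 0 <= t <= 1 -> `|v + t *: (u - v)| <= K.
  move=> /andP[t0 t1]; have -> : v + t *: (u - v) = t *: u + (1 - t) *: v.
    by rewrite scalerBl scale1r scalerBr addrCA addrA addrAC -addrA addrC.
  rewrite (le_trans (ler_normD _ _)) // !normrZ !ger0_norm ?subr_ge0 //.
  have : t * `|u| <= t * K by rewrite ler_wpM2l.
  have : (1 - t) * `|v| <= (1 - t) * K by rewrite ler_wpM2l // subr_ge0.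
  lra.
have -> : g u - g v = g (v + 1 *: (u - v)) - g (v + 0 *: (u - v)).
  by rewrite scale1r scale0r addr0 (addrC v) subrK.
rewrite -[leRHS]mulr1 -[X in _ * X](subr0 1).
apply: (@mean_value_bound _ (fun t => g (v + t *: (u - v)))
  (fun t => 'D_(u - v) g (v + t *: (u - v)))) => // [t t01|t t01].
  exact: is_derive_line.
rewrite deriveE_gradient // (le_trans (ler_norm_sum _ _ _)) // mulr_suml.
apply: ler_sum => j _; rewrite normrM ler_pM ?norm_entry_le //.
by rewrite mxE (le_trans _ (ler_norm _)) // HP // seg.
Qed.

Lemma ode_field_x (R : realType) (m n s : nat) (gamma sigma1 sigma2 : R)
    (f : 'cV[R]_n -> R) (A : 'M[R]_(m, n)) (b : 'cV[R]_m) x y (i : 'I_n) :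
  (ode_field s gamma sigma1 sigma2 f A b (x, y)).1 i 0 =
  - ((if (i < s)%N then x i 0 `^ gamma else 1) ^+ 2 *
     (gradient f x i 0 + (A^T *m y) i 0 + sigma1 * (A^T *m (A *m x - b)) i 0)).
Proof.
rewrite /ode_field /scaling_mx /= mxE expr2 -mulmxE -mulmxA !mul_diag_mx.
by rewrite !mxE mulrA expr2.
Qed.

Lemma ode_field_y (R : realType) (m n s : nat) (gamma sigma1 sigma2 : R)
    (f : 'cV[R]_n -> R) (A : 'M[R]_(m, n)) (b : 'cV[R]_m) x y (j : 'I_m) :
  (ode_field s gamma sigma1 sigma2 f A b (x, y)).2 j 0 =
  sigma2 * (A *m x - b) j 0.
Proof. by rewrite /ode_field /= mxE. Qed.

Section ode_field_lipschitz.
Variables (R : realType) (m n s : nat) (gamma sigma1 sigma2 : R).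
Variables (f : 'cV[R]_n -> R) (A : 'M[R]_(m, n)) (b : 'cV[R]_m).
Hypothesis f_C2 : twice_continuously_differentiable f.
Variables (eps K : R).
Hypothesis eps_gt0 : 0 < eps.

Let S := [set z : 'cV[R]_n * 'cV[R]_m | `|z| <= K /\
            forall i : 'I_n, (i < s)%N -> eps <= z.1 i 0].

Let bl := @bounded_lipschitz R _ S.

Let norm_fst (z : 'cV[R]_n * 'cV[R]_m) : `|z.1| <= `|z|.
Proof. by rewrite prod_normE le_max lexx. Qed.

Let norm_snd (z : 'cV[R]_n * 'cV[R]_m) : `|z.2| <= `|z|.
Proof. by rewrite prod_normE le_max lexx orbT. Qed.

Let bl_fst i : bl (fun z => z.1 i 0).
Proof.
exists (1 + `|K|); split => [|u [uK _]|u v _ _]; first exact: addr_ge0.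
  rewrite (le_trans (norm_entry_le _ _ _)) // (le_trans (norm_fst u)) //.
  by rewrite (le_trans uK) // (le_trans (ler_norm _)) // lerDr.
have -> : u.1 i 0 - v.1 i 0 = (u - v).1 i 0 by rewrite !mxE.
rewrite (le_trans (norm_entry_le _ _ _)) // (le_trans (norm_fst _)) //.
by rewrite ler_peMl // lerDl.
Qed.

Let bl_snd i : bl (fun z => z.2 i 0).
Proof.
exists (1 + `|K|); split => [|u [uK _]|u v _ _]; first exact: addr_ge0.
  rewrite (le_trans (norm_entry_le _ _ _)) // (le_trans (norm_snd u)) //.
  by rewrite (le_trans uK) // (le_trans (ler_norm _)) // lerDr.
have -> : u.2 i 0 - v.2 i 0 = (u - v).2 i 0 by rewrite !mxE.
rewrite (le_trans (norm_entry_le _ _ _)) // (le_trans (norm_snd _)) //.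
by rewrite ler_peMl // lerDl.
Qed.

Let bl_mulmx p q (B : 'M[R]_(p, q)) (g : _ -> 'cV[R]_q) i :
  (forall j, bl (fun z => g z j 0)) -> bl (fun z => (B *m g z) i 0).
Proof.
move=> H; have -> : (fun z => (B *m g z) i 0) =
    (fun z => \sum_j B i j * g z j 0) by apply/funext => z; rewrite mxE.
apply: bounded_lipschitz_sum => j.
by apply: bounded_lipschitzM; [exact: bounded_lipschitz_cst | exact: H].
Qed.

Let bl_residual j : bl (fun z => (A *m z.1 - b) j 0).
Proof.
have -> : (fun z : 'cV[R]_n * 'cV[R]_m => (A *m z.1 - b) j 0) =
    (fun z => (A *m z.1) j 0 + - b j 0) by apply/funext => z; rewrite !mxE.
by apply: bounded_lipschitzD; [by apply: bl_mulmx => k; exact: bl_fst | exact: bounded_lipschitz_cst].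
Qed.

Let bl_gradient i : bl (fun z => gradient f z.1 i 0).
Proof.
have [_ dg ch] := f_C2.
have [||L [L0 gL gl]] := @C1_bounded_lipschitz _ _ (fun x => gradient f x i 0) K.
- move=> x; apply: (@differentiable_comp _ _ _ _ (gradient f) (fun M => M i 0)).
    exact: dg.
  exact: differentiable_coord.
- move=> j; have -> : (fun x => 'D_(delta_mx j 0) (fun z => gradient f z i 0) x) =
      (fun x => hessian f x i j) by apply/funext => x; rewrite mxE.
  move=> x; apply: (@continuous_comp _ _ _ (hessian f) (fun M => M i j)).
    exact: ch.
  exact: coord_continuous.
have fstK u : S u -> `|u.1| <= K by move=> [uK _]; rewrite (le_trans (norm_fst u)).
exists L; split => // [u /fstK/gL//|u v /fstK uK /fstK vK].
by rewrite (le_trans (gl _ _ uK vK)) // ler_wpM2l // -[u.1 - v.1]/((u - v).1).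
Qed.

Let bl_power (i : 'I_n) : 0 <= gamma -> (i < s)%N -> bl (fun z => z.1 i 0 `^ gamma).
Proof.
move=> g0 si.
(* The bound on the derivative comes from writing [t] to the power [gamma - 1] as a quotient by [t],
   with [t] at most [|K|] in the numerator and at least [eps] in the denominator. *)
apply: (@bounded_lipschitz_comp _ _ S (fun t => t `^ gamma)
  (fun t => gamma * t `^ (gamma - 1)) (fun z => z.1 i 0) eps `|K|
  (gamma * (`|K| `^ gamma / eps))).
- exact: bl_fst.
- move=> u [uK ueps]; rewrite ueps //= (le_trans (ler_norm _)) //.
  rewrite (le_trans (norm_entry_le _ _ _)) // (le_trans (norm_fst u)) //.
  by rewrite (le_trans uK) // ler_norm.
- move=> t /andP[et _]; apply: is_derive1_powR; exact: lt_le_trans et.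
- move=> t /andP[et tK]; have t0 : 0 < t by exact: lt_le_trans et.
  rewrite ger0_norm ?mulr_ge0 ?powR_ge0 // ler_wpM2l //.
  rewrite powRB ?(gt_eqF t0) ?implybT // (powRr1 (ltW t0)).
  rewrite ler_pM ?powR_ge0 ?invr_ge0 ?(ltW t0) ?lef_pV2 ?posrE //.
  by rewrite ge0_ler_powR ?nnegrE ?(ltW t0) ?normr_ge0.
Qed.

Lemma ode_field_bounded_lipschitz_x i : 0 <= gamma ->
  bl (fun z => (ode_field s gamma sigma1 sigma2 f A b z).1 i 0).
Proof.
move=> g0; have -> : (fun z => (ode_field s gamma sigma1 sigma2 f A b z).1 i 0) =
  (fun z => -1 * ((if (i < s)%N then z.1 i 0 `^ gamma else 1) *
     (if (i < s)%N then z.1 i 0 `^ gamma else 1) *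
     (gradient f z.1 i 0 + (A^T *m z.2) i 0 +
      sigma1 * (A^T *m (A *m z.1 - b)) i 0))).
  apply/funext => z; rewrite [in LHS](surjective_pairing z) ode_field_x mulN1r expr2.
  by [].
have bl_if : bl (fun z => if (i < s)%N then z.1 i 0 `^ gamma else 1).
  by case: (boolP (i < s)%N) => si; [exact: bl_power | exact: bounded_lipschitz_cst].
apply: bounded_lipschitzM; first exact: bounded_lipschitz_cst.
apply: bounded_lipschitzM; first exact: bounded_lipschitzM.
apply: bounded_lipschitzD.
  by apply: bounded_lipschitzD; [exact: bl_gradient | by apply: bl_mulmx => k; exact: bl_snd].
apply: bounded_lipschitzM; first exact: bounded_lipschitz_cst.
by apply: bl_mulmx => k; exact: bl_residual.
Qed.

Lemma ode_field_bounded_lipschitz_y j :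
  bl (fun z => (ode_field s gamma sigma1 sigma2 f A b z).2 j 0).
Proof.
have -> : (fun z => (ode_field s gamma sigma1 sigma2 f A b z).2 j 0) =
    (fun z => sigma2 * (A *m z.1 - b) j 0).
  by apply/funext => z; rewrite [in LHS](surjective_pairing z) ode_field_y.
by apply: bounded_lipschitzM; [exact: bounded_lipschitz_cst | exact: bl_residual].
Qed.

End ode_field_lipschitz.

(** * Local solutions *)

Lemma is_derive_pair_cV (R : realType) (m n : nat) (x : R -> 'cV[R]_n)
    (y : R -> 'cV[R]_m) (t : R)
    (dx : 'cV[R]_n) (dy : 'cV[R]_m) :
  (forall i, is_derive t 1 (fun t => x t i 0) (dx i 0)) ->
  (forall j, is_derive t 1 (fun t => y t j 0) (dy j 0)) ->
  is_derive t 1 (fun t => (x t, y t)) (dx, dy).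
Proof.
have is_derive_cV k (v : R -> 'cV[R]_k) (dv : 'cV[R]_k) :
    (forall i, is_derive t 1 (fun t => v t i 0) (dv i 0)) -> is_derive t 1 v dv.
  move=> H; have dvb : derivable v t 1.
    by apply/derivable_mxP => i j; rewrite ord1; have [] := H i.
  split=> //; rewrite derive_mx //; apply/colP => i; rewrite mxE.
  by have [] := H i.
move=> /is_derive_cV[xd xE] /is_derive_cV[yd yE].
have H : h^-1 *: ((x (h *: 1 + t), y (h *: 1 + t)) - (x t, y t)) @[h --> 0^'] -->
    (dx, dy).
  rewrite -xE -yE; apply: (@cvg_pair _ _ _ _ (nbhs ('D_1 x t)) (nbhs ('D_1 y t))).
    exact: xd.
  exact: yd.
by split; [apply/cvg_ex; exists (dx, dy) | exact: cvg_lim H].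
Qed.

Lemma is_derive_linear_comp (R : realType) (V : normedModType R)
    (l : V -> R) (z : R -> V) (t : R) (dz : V) :
  linear (l : V -> R^o) -> continuous l -> is_derive t 1 z dz ->
  is_derive t 1 (l \o z) (l dz).
Proof.
move=> ll lc [zd zE].
pose lin := GRing.isLinear.Build _ _ _ _ _ ll.
pose L : {linear V -> R^o} := HB.pack l lin.
have H : h^-1 *: (l (z (h *: 1 + t)) - l (z t)) @[h --> 0^'] --> l dz.
  have -> : (fun h : R => h^-1 *: (l (z (h *: 1 + t)) - l (z t))) =
      l \o (fun h => h^-1 *: (z (h *: 1 + t) - z t)).
    apply/funext => h /=.
    have -> : l (h^-1 *: (z (h *: 1 + t) - z t)) =
        h^-1 *: (L (z (h *: 1 + t) - z t) : R^o) by rewrite -linearZ.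
    by rewrite (linearB L).
  rewrite -zE; apply: (@cvg_comp _ _ _ _ _ _ (nbhs ('D_1 z t))); [exact: zd | exact: lc].
by split; [apply/cvg_ex; exists (l dz) | exact: cvg_lim H].
Qed.

Lemma is_derive_fst_entry (R : realType) (m n : nat) (z : R -> 'cV[R]_n * 'cV[R]_m)
    (t : R)
    (dz : 'cV[R]_n * 'cV[R]_m) i :
  is_derive t 1 z dz -> is_derive t 1 (fun t => (z t).1 i 0) (dz.1 i 0).
Proof.
apply: (@is_derive_linear_comp _ _ (fun z : 'cV[R]_n * 'cV[R]_m => z.1 i 0)).
  by move=> a u v; rewrite !mxE.
move=> u; apply: (@continuous_comp _ _ _ fst (fun M : 'cV[R]_n => M i 0)).
  exact: cvg_fst.
exact: coord_continuous.
Qed.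

Lemma is_derive_snd_entry (R : realType) (m n : nat) (z : R -> 'cV[R]_n * 'cV[R]_m)
    (t : R)
    (dz : 'cV[R]_n * 'cV[R]_m) i :
  is_derive t 1 z dz -> is_derive t 1 (fun t => (z t).2 i 0) (dz.2 i 0).
Proof.
apply: (@is_derive_linear_comp _ _ (fun z : 'cV[R]_n * 'cV[R]_m => z.2 i 0)).
  by move=> a u v; rewrite !mxE.
move=> u; apply: (@continuous_comp _ _ _ snd (fun M : 'cV[R]_m => M i 0)).
  exact: cvg_snd.
exact: coord_continuous.
Qed.

Lemma is_derive_translate (R : realType) (V : normedModType R) (u : R -> V)
    (t a : R) (d : V) :
  is_derive (t - a) 1 u d -> is_derive t 1 (fun t => u (t - a)) d.
Proof.
rewrite /derivable /derive /= => -[ud uE].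
have E : (fun h : R => h^-1 *: (u (h *: 1 + t - a) - u (t - a))) =
    (fun h => h^-1 *: (u (h *: 1 + (t - a)) - u (t - a))).
  by apply/funext => h; rewrite addrA.
by split; rewrite /derivable /derive /= E.
Qed.

(** At the junction the values agree, so each difference quotient of the glued function is one of
    [z] or one of [u], and both families tend to [d]. *)
Lemma is_derive_glue (R : realType) (V : normedModType R) (z u : R -> V)
    (a t : R) (d : V) :
  z a = u a -> (t <= a -> is_derive t 1 z d) -> (a <= t -> is_derive t 1 u d) ->
  is_derive t 1 (fun t => if t <= a then z t else u t) d.
Proof.
move=> zua dz du; have [ta|at_|tE] := ltgtP t a.
- apply: (@near_eq_is_derive _ _ _ z); last exact/dz/ltW.
  near=> s; rewrite ifT // ltW //; near: s; exact: lt_nbhsl.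
- apply: (@near_eq_is_derive _ _ _ u); last exact/du/ltW.
  near=> s; rewrite ifF //; apply/negbTE; rewrite -ltNge; near: s; exact: lt_nbhsr.
subst a; have [zd zE] := dz (lexx t); have [ud uE] := du (lexx t).
have H : h^-1 *: ((if h *: 1 + t <= t then z (h *: 1 + t) else u (h *: 1 + t))
    - (if t <= t then z t else u t)) @[h --> 0^'] --> d.
  apply/cvgrPdist_le => e e0; rewrite lexx; near=> h.
  case: ifP => _; last first.
    rewrite zua; near: h; move: e e0; apply/cvgrPdist_le.
    by rewrite -uE; exact: ud.
  near: h; move: e e0; apply/cvgrPdist_le.
  by rewrite -zE; exact: zd.
by split; [apply/cvg_ex; exists d | exact: cvg_lim H].
Unshelve. all: by end_near. Qed.

Lemma uniform_bounded_lipschitz (R : realType) (V : normedModType R) (S : set V)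
    (I : finType) (g : I -> V -> R) :
  (forall i, bounded_lipschitz S (g i)) ->
  exists L, [/\ 0 <= L, forall i u, S u -> `|g i u| <= L
    & forall i u v, S u -> S v -> `|g i u - g i v| <= L * `|u - v|].
Proof.
move=> /choice[L HL]; exists (\sum_i L i).
have L0 i : 0 <= L i by have [] := HL i.
have Lle i : L i <= \sum_i L i by rewrite (bigD1 i) //= lerDl sumr_ge0.
split=> [|i u Su|i u v Su Sv]; first by rewrite sumr_ge0.
  by have [_ + _] := HL i => /(_ u Su) h; exact: (le_trans h).
have [_ _ /(_ u v Su Sv) h] := HL i.
by apply: (le_trans h); rewrite ler_wpM2r.
Qed.

(** Picard-Lindelof for the coordinates of both components, gathered into one family indexed by
    ['I_n + 'I_m]. The length [delta] is chosen before [z0]. *)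
Lemma ode_local_solution (R : realType) (m n s : nat)
    (gamma sigma1 sigma2 : R) (f : 'cV[R]_n -> R) (A : 'M[R]_(m, n))
    (b : 'cV[R]_m) (eps K : R) :
  twice_continuously_differentiable f -> 0 <= gamma -> 0 < eps ->
  exists2 delta, 0 < delta & forall z0 : 'cV[R]_n * 'cV[R]_m,
    `|z0| <= K -> (forall i : 'I_n, (i < s)%N -> eps <= z0.1 i 0) ->
    exists w : R -> 'cV[R]_n * 'cV[R]_m, w 0 = z0 /\
      forall t, 0 <= t <= delta ->
        positive_part_space s (w t).1 /\
        is_derive t 1 w (ode_field s gamma sigma1 sigma2 f A b (w t)).
Proof.
move=> f_C2 gamma0 eps0.
set F := ode_field s gamma sigma1 sigma2 f A b.
(* Moving each coordinate by at most [eps / 2] leaves the constrained ones at least [eps / 2]. *)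
pose r := eps / 2; have r0 : 0 < r by rewrite divr_gt0.
pose S := [set z : 'cV[R]_n * 'cV[R]_m | `|z| <= K + r /\
            forall i : 'I_n, (i < s)%N -> r <= z.1 i 0].
pose g (k : 'I_n + 'I_m) z := match k with
  | inl i => (F z).1 i 0 | inr j => (F z).2 j 0 end.
have [|L [L0 gL gl]] := @uniform_bounded_lipschitz _ _ S _ g.
  case=> [i|j]; first exact: ode_field_bounded_lipschitz_x.
  exact: ode_field_bounded_lipschitz_y.
(* Dividing [q] by [L + 1] meets both smallness conditions of the Picard scheme, where [L] serves as
   bound and as Lipschitz constant. *)
pose q := Num.min r 2^-1; have q0 : 0 < q by rewrite lt_min r0 invr_gt0 /=.
have L1 : 0 < L + 1 by rewrite ltr_wpDl.
pose delta := q / (L + 1); have delta0 : 0 < delta by rewrite divr_gt0.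
have Ldelta : L * delta <= q.
  by rewrite /delta mulrCA ger_pMr // ler_pdivrMr // mul1r lerDl.
exists delta => // z0 z0K z0eps.
pose pk (u : 'I_n + 'I_m -> R) : 'cV[R]_n * 'cV[R]_m :=
  (\col_i u (inl i), \col_j u (inr j)).
pose p (k : 'I_n + 'I_m) := match k with
  | inl i => z0.1 i 0 | inr j => z0.2 j 0 end.
have pkp : pk p = z0.
  rewrite [RHS]surjective_pairing /pk.
  by congr (_, _); apply/colP => i; rewrite mxE.
have pk_dist u v d : 0 <= d -> (forall k, `|u k - v k| <= d) ->
    `|pk u - pk v| <= d.
  move=> d0 uv; rewrite prod_normE ge_max.
  by apply/andP; split; apply: norm_cV_le => // i; rewrite !mxE; exact: uv.
have pkS u : (forall k, `|u k - p k| <= r) -> S (pk u).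
  move=> up; split=> [|i si].
    rewrite -[pk u](subrK (pk p)) (le_trans (ler_normD _ _)) // addrC lerD //.
      by rewrite pkp.
    by apply: pk_dist => //; exact: ltW.
  have := up (inl i); rewrite ler_norml /= => /andP[h _].
  by rewrite mxE; move: (z0eps i si) h; rewrite /r; lra.
have [|||u v d up vp d0 uv k|w [w0 wr dw]] :=
  @picard_lindelof R _ (fun u k => g k (pk u)) p r L L delta delta0 L0 L0.
- by rewrite (le_trans Ldelta) // ge_min lexx.
- by rewrite (le_trans Ldelta) // ge_min lexx orbT.
- by move=> u /pkS up k; exact: gL.
- apply: (le_trans (gl k _ _ (pkS u up) (pkS v vp))).
  by rewrite ler_wpM2l // pk_dist.
exists (fun t => pk (w^~ t)); split.
  by rewrite -pkp; congr pk; apply/funext => k; exact: w0.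
move=> t t01; split=> [i si|].
  have [_ /(_ i si)] := pkS (w^~ t) (wr t t01).
  by apply: lt_le_trans.
rewrite [X in is_derive _ _ _ X]surjective_pairing; apply: is_derive_pair_cV => k.
  have -> : (fun t => (\col_i w (inl i) t) k 0) = w (inl k).
    by apply/funext => t'; rewrite mxE.
  exact: (dw (inl k) t t01).
have -> : (fun t => (\col_j w (inr j) t) k 0) = w (inr k).
  by apply/funext => t'; rewrite mxE.
exact: (dw (inr k) t t01).
Qed.

(** * A priori bounds *)

Lemma le_of_derive_le0 (R : realType) (G g : R -> R) (a b : R) :
  a <= b -> (forall t, a <= t <= b -> is_derive t 1 G (g t)) ->
  (forall t, a <= t <= b -> g t <= 0) -> G b <= G a.
Proof.
move=> ab dG g0.
have [||c cab E] := MVT_segment ab (f := G) (df := g).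
- by move=> t; rewrite in_itv /= => /andP[? ?]; apply: dG; rewrite !ltW.
- apply: (@derivable_within_continuous _ _ G `[a, b]) => t; rewrite in_itv /= => tab.
  by have [] := dG t tab.
- by rewrite -subr_le0 E mulr_le0_ge0 ?subr_ge0 // g0 //; rewrite in_itv in cab.
Qed.

(** A crude substitute for a square root, from [|a| <= a ^+ 2 + 1]. *)
Lemma norm_le_sqr_add1 (R : realType) (a M : R) : a ^+ 2 <= M -> `|a| <= M + 1.
Proof. by move=> aM; rewrite ler_norml; apply/andP; split; nra. Qed.

(** The boolean [c] marks a sign-constrained coordinate. For a free one the weight is 1 and half the
    squared distance to [p] serves. *)
Lemma coordinate_entropy (R : realType) (gamma p : R) (c : bool) :
  2^-1 <= gamma -> gamma < 1 -> (c -> 0 <= p) ->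
  exists D : R -> R,
    [/\ forall u : R, (c -> 0 < u) ->
          is_derive u 1 D ((u - p) / (if c then u `^ gamma else 1) ^+ 2),
        forall u : R, (c -> 0 < u) -> 0 <= D u
      & forall C, exists K, forall u : R, (c -> 0 < u) -> D u <= C -> `|u| <= K].
Proof.
move=> g1 g2; case: c => [p0|_].
  have [D [dD D0 DC]] := entropy_function g1 g2 (p0 isT).
  exists D; split => [u /(_ isT)|u /(_ isT)|C]; [exact: dD | exact: D0 |].
  have [K HK] := DC C; exists K => u /(_ isT) u0 Du.
  by rewrite (ger0_norm (ltW u0)) HK.
exists (fun u => 2^-1 * (u - p) ^+ 2); split => [u _|u _|C].
- have -> : (fun u => 2^-1 * (u - p) ^+ 2) = 2^-1 *: (id - cst p) ^+ 2 by [].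
  apply: is_derive_eq; rewrite /GRing.scale /= expr1n divr1 subr0 expr1.
  by rewrite mulr1 -[(id - cst p) u]/(u - p) -mulr_natl mulrA mulVf ?mul1r ?pnatr_eq0.
- by rewrite mulr_ge0 ?invr_ge0 // sqr_ge0.
exists (2 * C + 1 + `|p|) => u _ Du.
have h : `|u - p| <= 2 * C + 1 by apply: norm_le_sqr_add1; lra.
by rewrite -[u](subrK p) (le_trans (ler_normD _ _)) // lerD2r.
Qed.

Section a_priori_bounds.
Variables (R : realType) (m n s : nat) (f : 'cV[R]_n -> R).
Variables (A : 'M[R]_(m, n)) (b : 'cV[R]_m) (gamma sigma1 sigma2 : R).
Variables (t1 r : R) (x : R -> 'cV[R]_n) (y : R -> 'cV[R]_m).

Let F := ode_field s gamma sigma1 sigma2 f A b.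

Hypotheses (gamma_ge : 2^-1 <= gamma) (gamma_lt1 : gamma < 1).
Hypotheses (sigma1_gt0 : 0 < sigma1) (sigma2_gt0 : 0 < sigma2).
Hypothesis x_pos : forall t, t1 <= t < r -> positive_part_space s (x t).
Hypothesis xy_sol : forall t, t1 <= t < r ->
  is_derive t 1 (fun t => (x t, y t)) (F (x t, y t)).

Let dx t i : t1 <= t < r -> is_derive t 1 (fun t => x t i 0) ((F (x t, y t)).1 i 0).
Proof. by move=> /xy_sol /is_derive_fst_entry; exact. Qed.

Let dy t j : t1 <= t < r -> is_derive t 1 (fun t => y t j 0) ((F (x t, y t)).2 j 0).
Proof. by move=> /xy_sol /is_derive_snd_entry; exact. Qed.

(* The weights x_i^(-2 gamma) in the derivative of the entropies cancel the
   scaling U(x)^2; the saddle-point terms in y and mu cancel as well. *)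
Let dissipation (xs : 'cV[R]_n) (mu : 'rV[R]_m) t : t1 <= t < r ->
  convex_on_space f -> (forall x, differentiable f x) ->
  A *m xs = b ->
  (forall d : 'cV[R]_n,
    (forall i : 'I_n, (i < s)%N -> xs i 0 = 0 -> 0 <= d i 0) ->
    (mu *m A *m d) 0 0 <= 'D_d f xs) ->
  \sum_(i < n) (x t i 0 - xs i 0) /
      (if (i < s)%N then x t i 0 `^ gamma else 1) ^+ 2 * (F (x t, y t)).1 i 0 +
  \sum_(j < m) sigma2^-1 * (y t j 0 + mu 0 j) * (F (x t, y t)).2 j 0 <= 0.
Proof.
move=> t1r fc df Axs Hmu; set d := x t - xs.
have [rho rhoD] : exists rho, rho = A *m x t - b by exists (A *m x t - b).
have [g gD] : exists g, g = gradient f (x t) by exists (gradient f (x t)).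
have rhoE : rho = A *m d by rewrite rhoD /d mulmxBr Axs.
have E1 : \sum_(i < n) (x t i 0 - xs i 0) /
      (if (i < s)%N then x t i 0 `^ gamma else 1) ^+ 2 * (F (x t, y t)).1 i 0 =
    - (d^T *m (g + A^T *m y t + sigma1 *: (A^T *m rho))) 0 0.
  rewrite mxE -sumrN; apply: eq_bigr => i _; rewrite (@ode_field_x _ _ _ s gamma sigma1 sigma2 f A b (x t) (y t)).
  have w0 : (if (i < s)%N then x t i 0 `^ gamma else 1) ^+ 2 != 0.
    rewrite expf_neq0 //; case: (boolP (i < s)%N) => [si|_]; last exact: oner_neq0.
    by rewrite gt_eqF // powR_gt0 // x_pos.
  by rewrite mulrN mulrA divfK // gD -rhoD !mxE.
have E2 : \sum_(j < m) sigma2^-1 * (y t j 0 + mu 0 j) * (F (x t, y t)).2 j 0 =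
    (rho^T *m y t) 0 0 + (mu *m rho) 0 0.
  rewrite !mxE -big_split /=; apply: eq_bigr => j _; rewrite (@ode_field_y _ _ _ s gamma sigma1 sigma2 f A b (x t) (y t)).
  by rewrite -rhoD mxE; field; rewrite gt_eqF.
have E3 : d^T *m (g + A^T *m y t + sigma1 *: (A^T *m rho)) =
    d^T *m g + rho^T *m y t + sigma1 *: (rho^T *m rho).
  by rewrite !mulmxDr -scalemxAr !mulmxA -trmx_mul -rhoE.
have rho2 : 0 <= (rho^T *m rho) 0 0.
  by rewrite mxE; apply: sumr_ge0 => k _; rewrite mxE -expr2 sqr_ge0.
have Dg : (d^T *m g) 0 0 = 'D_d f (x t).
  rewrite deriveE_gradient // mxE gD; apply: eq_bigr => i _.
  by rewrite [d^T _ _]mxE mulrC.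
have mono := convex_gradient_monotone fc (df xs) (df (x t)).
(* The direction [d] is allowed: where a constrained coordinate of [xs] vanishes, that of [d] equals
   the positive one of [x t]. *)
have {}Hmu : (mu *m rho) 0 0 <= 'D_d f xs.
  rewrite rhoE mulmxA; apply: Hmu => i si xi; rewrite !mxE xi subr0 ltW //; exact: x_pos.
have E4 : (d^T *m (g + A^T *m y t + sigma1 *: (A^T *m rho))) 0 0 =
    'D_d f (x t) + (rho^T *m y t) 0 0 + sigma1 * (rho^T *m rho) 0 0.
  by rewrite E3 [LHS]mxE [X in X + _]mxE Dg [X in _ + X]mxE.
rewrite E1 E2 E4.
have : 0 <= sigma1 * (rho^T *m rho) 0 0 by rewrite mulr_ge0 // ltW.
move: Hmu mono; rewrite -/d.
move: ('D_d f xs) ('D_d f (x t)) ((rho^T *m y t) 0 0) ((mu *m rho) 0 0) => *.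
lra.
Qed.

(** All terms of [V] are nonnegative, so its decrease bounds each of them by [V t1], and each has
    bounded sublevel sets. *)
Lemma solution_bounded (xs : 'cV[R]_n) (mu : 'rV[R]_m) :
  t1 < r -> convex_on_space f -> (forall x, differentiable f x) ->
  A *m xs = b -> (forall i : 'I_n, (i < s)%N -> 0 <= xs i 0) ->
  (forall d : 'cV[R]_n,
    (forall i : 'I_n, (i < s)%N -> xs i 0 = 0 -> 0 <= d i 0) ->
    (mu *m A *m d) 0 0 <= 'D_d f xs) ->
  exists K, forall t, t1 <= t < r -> `|(x t, y t)| <= K.
Proof.
move=> t1r fc df Axs xs0 Hmu.
have [D HD] := choice (fun i : 'I_n =>
  @coordinate_entropy R gamma (xs i 0) (i < s)%N gamma_ge gamma_lt1 (xs0 i)).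
(* Its derivative is [(u + mu 0 j) / sigma2], which cancels the factor [sigma2] of the equation for
   [y]. *)
pose E (j : 'I_m) u := (2 * sigma2)^-1 * (u + mu 0 j) ^+ 2.
pose V t := \sum_(i < n) D i (x t i 0) + \sum_(j < m) E j (y t j 0).
have E0 j u : 0 <= E j u.
  by rewrite mulr_ge0 ?sqr_ge0 // invr_ge0 mulr_ge0 // ltW.
have D0 i t : t1 <= t < r -> 0 <= D i (x t i 0).
  by move=> t01; have [_ + _] := HD i; apply => si; exact: x_pos.
have Vdec t : t1 <= t < r -> V t <= V t1.
  move=> /andP[t1t tr].
  apply: (@le_of_derive_le0 _ V (fun t =>
    \sum_(i < n) (x t i 0 - xs i 0) /
      (if (i < s)%N then x t i 0 `^ gamma else 1) ^+ 2 * (F (x t, y t)).1 i 0 +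
    \sum_(j < m) sigma2^-1 * (y t j 0 + mu 0 j) * (F (x t, y t)).2 j 0)) => //;
    last first.
    move=> q /andP[t1q qt]; apply: dissipation => //.
    by rewrite t1q (le_lt_trans qt).
  move=> q /andP[t1q qt]; have q01 : t1 <= q < r by rewrite t1q (le_lt_trans qt).
  have -> : V = (\sum_(i < n) (D i \o (fun t => x t i 0))) +
      (\sum_(j < m) (E j \o (fun t => y t j 0))).
    by apply/funext => q'; rewrite /V !fctE !fct_sumE.
  apply: is_deriveD; apply: is_derive_sum => k.
    apply: is_derive1_comp; last exact: dx.
    by have [+ _ _] := HD k; apply => si; exact: x_pos.
  apply: is_derive1_comp; last exact: dy.
  have -> : E k = (2 * sigma2)^-1 *: (id + cst (mu 0 k)) ^+ 2 by [].
  apply: is_derive_eq; rewrite /GRing.scale /= expr1 addr0 mulr1.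
  rewrite -[(id + _) (y q k 0)]/(y q k 0 + mu 0 k).
  by field; rewrite gt_eqF.
have [KD HKD] := choice (fun i : 'I_n => let: And3 _ _ H := HD i in H (V t1)).
(* [E k <= V t1] bounds the square of [y_k + mu_k] by [2 * sigma2 * V t1]; the 1 comes from
   [norm_le_sqr_add1]. *)
pose M := 2 * sigma2 * V t1 + 1.
have V0 t : t1 <= t < r -> 0 <= V t.
  by move=> t01; rewrite addr_ge0 ?sumr_ge0 // => i _; exact: D0.
have M0 : 0 <= M.
  by rewrite /M addr_ge0 // mulr_ge0 ?V0 ?lexx ?mulr_ge0 // ltW.
pose K := \sum_(i < n) `|KD i| + \sum_(j < m) (M + `|mu 0 j|).
have S1 : 0 <= \sum_(i < n) `|KD i| by rewrite sumr_ge0.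
have S2 : 0 <= \sum_(j < m) (M + `|mu 0 j|) by rewrite sumr_ge0 // => j _; rewrite addr_ge0.
have K0 : 0 <= K by rewrite addr_ge0.
exists K => t t01; have Vt := Vdec t t01.
rewrite prod_normE ge_max; apply/andP; split; apply: norm_cV_le => // k /=.
  have kM : `|KD k| <= K.
    rewrite /K (bigD1 k) //= -addrA lerDl addr_ge0 // sumr_ge0 //.
  apply: le_trans kM; apply: le_trans (ler_norm _).
  apply: HKD => [si|]; first exact: x_pos.
  apply: le_trans Vt; rewrite /V (bigD1 k) //= -addrA lerDl.
  rewrite addr_ge0 ?sumr_ge0 // => j _; exact: D0.
have kM : M + `|mu 0 k| <= K.
  rewrite /K (bigD1 (k : 'I_m)) //=; set c := \sum_(j < m | j != k) _.
  have : 0 <= c by rewrite sumr_ge0 // => j _; rewrite addr_ge0.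
  by move: S1; lra.
apply: le_trans kM.
have Ek : E k (y t k 0) <= V t1.
  apply: le_trans Vt; rewrite /V (bigD1 k) //= addrCA lerDl.
  by rewrite addr_ge0 ?sumr_ge0 // => j _; exact: D0.
have h : `|y t k 0 + mu 0 k| <= M.
  by apply: norm_le_sqr_add1; rewrite -ler_pdivrMl ?mulr_gt0.
by rewrite -[y t k 0](addrK (mu 0 k)) (le_trans (ler_normB _ _)) // lerD2r.
Qed.

(* ln x_i has derivative - x_i^(2 gamma - 1) g_i, which is bounded because
   2 gamma - 1 >= 0. *)
Lemma solution_away_from_boundary K : t1 < r ->
  twice_continuously_differentiable f ->
  (forall t, t1 <= t < r -> `|(x t, y t)| <= K) ->
  exists2 eps, 0 < eps &
    forall t, t1 <= t < r -> forall i : 'I_n, (i < s)%N -> eps <= x t i 0.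
Proof.
move=> t1r f_C2 xyK.
have gamma0 : 0 <= gamma by apply: le_trans gamma_ge; rewrite invr_ge0.
(* With no sign constraint the scaling is the identity, so the field is - g_i. *)
pose g (i : 'I_n) z := (ode_field 0 gamma sigma1 sigma2 f A b z).1 i 0.
(* No index is below 0, so [S] is a full ball and the lower bound 1 is arbitrary. *)
pose S := [set z : 'cV[R]_n * 'cV[R]_m | `|z| <= K /\
             forall i : 'I_n, (i < 0)%N -> 1 <= z.1 i 0].
have [i|G [G0 gG _]] := @uniform_bounded_lipschitz _ _ S _ g.
  exact: (@ode_field_bounded_lipschitz_x R m n 0 gamma sigma1 sigma2 f A b f_C2 1 K).
have {}gG i t : t1 <= t < r -> `|g i (x t, y t)| <= G.
  by move=> t01; apply: gG; split => //; exact: xyK.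
pose k := 2 * gamma - 1; have k0 : 0 <= k by rewrite /k; move: gamma_ge; lra.
have K0 : 0 <= K by rewrite (le_trans _ (xyK t1 _)) // lexx.
pose C := K `^ k * G; have C0 : 0 <= C by rewrite mulr_ge0 ?powR_ge0.
(* Integrating the bound [C] on the derivative of [ln x_i] over the full length [r - t1] gives a
   lower bound independent of [t]. *)
pose lo i := expR (ln (x t1 i 0) - C * (r - t1)).
exists (\big[Num.min/1]_(i < n) lo i).
  elim/big_ind: _ => [|u v u0 v0|i _]; first exact: ltr01.
    by rewrite lt_min u0.
  exact: expR_gt0.
move=> t /andP[t1t tr] i si.
have t01 : t1 <= t < r by rewrite t1t.
apply: (@le_trans _ _ (lo i)); first exact: bigmin_le.
have xi0 : 0 < x t i 0 by exact: x_pos.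
rewrite -[leRHS]lnK ?posrE // ler_expR.
have h : `|ln (x t i 0) - ln (x t1 i 0)| <= C * (t - t1).
  apply: (@mean_value_bound _ (@ln R \o (fun t => x t i 0))
    (fun t => (x t i 0)^-1 * (F (x t, y t)).1 i 0)) => // q /andP[t1q qt];
    have q01 : t1 <= q < r by rewrite t1q (le_lt_trans qt).
    apply: is_derive1_comp; last exact: dx.
    by apply: is_derive1_ln; exact: x_pos.
  have q0 : 0 < x q i 0 by exact: x_pos.
  have -> : (x q i 0)^-1 * (F (x q, y q)).1 i 0 = x q i 0 `^ k * g i (x q, y q).
    rewrite /F /g !ode_field_x si ltn0 expr1n mul1r mulrN mulrA powR_sqr mulrN.
    by rewrite /k powRB ?(gt_eqF q0) ?implybT // powRr1 ?(ltW q0) // (mulrC _^-1).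
  rewrite normrM ler_pM ?gG // ger0_norm ?powR_ge0 // ge0_ler_powR ?nnegrE ?(ltW q0) //.
  rewrite (le_trans (ler_norm _)) // (le_trans (norm_entry_le _ _ _)) //.
  by apply: le_trans (xyK q q01); rewrite prod_normE le_max lexx.
have : C * (t - t1) <= C * (r - t1) by rewrite ler_wpM2l // lerD2r ltW.
move: h; rewrite ler_norml => /andP[h _]; lra.
Qed.

End a_priori_bounds.

(** * Continuation past a finite endpoint *)

Theorem theorem2p9 (R : realType) (m n s : nat) (f : 'cV[R]_n -> R)
    (A : 'M[R]_(m, n)) (b : 'cV[R]_m) (gamma t0 sigma1 sigma2 : R)
    (x0 : 'cV[R]_n) (y0 : 'cV[R]_m)
    (alpha : \bar R) (x : R -> 'cV[R]_n) (y : R -> 'cV[R]_m)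
    (f_convex : convex_on_space f)
    (f_C2 : twice_continuously_differentiable f)
    (A_rank : \rank A = m)
    (s_le_n : (s <= n)%N)
    (gamma_ge : 2^-1 <= gamma) (gamma_lt1 : gamma < 1)
    (t0_ge0 : 0 <= t0) (sigma1_gt0 : 0 < sigma1) (sigma2_gt0 : 0 < sigma2)
    (has_solution : exists xs, is_minimizer f (feasible_set s A b) xs)
    (x0_pos : positive_part_space s x0)
    (xy_maximal :
       is_maximal_ivp_solution (positive_part_space s `*` [set: 'cV[R]_m])
         (ode_field s gamma sigma1 sigma2 f A b) t0 (x0, y0)
         alpha (fun t => (x t, y t))) :
  alpha = +oo%E.
Proof.
have [df dg _] := f_C2.
have [xs xs_min] := has_solution; have [[Axs xs_ge0] _] := xs_min.
have [mu Hmu] := kkt_multiplier (df xs) xs_min.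
have gamma0 : 0 <= gamma by apply: le_trans gamma_ge; rewrite invr_ge0.
set F := ode_field s gamma sigma1 sigma2 f A b in xy_maximal.
pose z t := (x t, y t).
case: xy_maximal => -[t0r z0E z_pos dz dz0] z_max.
(* The value [-oo] contradicts [t0 < alpha]; only a real endpoint [r] remains to be refuted. *)
case: alpha t0r z_pos dz z_max => [r| |] //; rewrite lte_fin => t0r z_pos dz z_max.
(* The estimates start after [t0], where only a right derivative is given. *)
pose t1 := (t0 + r) / 2; have t0t1 : t0 < t1 by rewrite /t1; lra.
have t1r : t1 < r by rewrite /t1; lra.
have x_pos t : t1 <= t < r -> positive_part_space s (x t).
  move=> /andP[t1t tr]; have t0t : t0 <= t by rewrite (le_trans (ltW t0t1)).
  by have [] := z_pos t t0t tr.
have xy_sol t : t1 <= t < r -> is_derive t 1 z (F (z t)).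
  by move=> /andP[t1t tr]; apply: dz; rewrite ?lte_fin // (lt_le_trans t0t1).
have [K zK] := solution_bounded gamma_ge gamma_lt1 sigma1_gt0 sigma2_gt0
  x_pos xy_sol t1r f_convex df Axs xs_ge0 Hmu.
have [eps eps0 x_eps] := solution_away_from_boundary gamma_ge x_pos xy_sol t1r f_C2 zK.
have [delta delta0 Hdelta] := @ode_local_solution R m n s gamma sigma1 sigma2
  f A b eps K f_C2 gamma0 eps0.
(* The restart time lies within [delta / 2] of [r], and not before [t1], so that the bounds hold
   there. *)
pose t2 := Num.max t1 (r - delta / 2).
have t1t2 : t1 <= t2 by rewrite le_max lexx.
have t2r : t2 < r by rewrite gt_max t1r ltrBlDr ltrDl divr_gt0.
have rt2 : r < t2 + delta.
  have : r - delta / 2 <= t2 by rewrite le_max lexx orbT.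
  by move: delta0; lra.
have t0t2 : t0 < t2 by exact: lt_le_trans t1t2.
have t2_itv : t1 <= t2 < r by rewrite t1t2.
have [u [u0 Hu]] := Hdelta (z t2) (zK t2 t2_itv) (x_eps t2 t2_itv).
pose w t := if t <= t2 then z t else u (t - t2).
have z_u : z t2 = u (t2 - t2) by rewrite subrr u0.
have wz t : t <= t2 -> w t = z t by rewrite /w => ->.
have wu t : t2 <= t -> w t = u (t - t2).
  rewrite le_eqVlt => /predU1P[<-|t2t]; first by rewrite wz.
  by rewrite /w leNgt t2t.
have u_itv t : t2 <= t -> t < t2 + delta -> 0 <= t - t2 <= delta.
  by move=> ? ?; apply/andP; split; lra.
suff /z_max : is_ivp_solution (positive_part_space s `*` [set: 'cV[R]_m])
    F t0 (x0, y0) (t2 + delta)%:E w by rewrite lee_fin leNgt rt2.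
split.
- by rewrite lte_fin (lt_trans t0r).
- by rewrite wz // ltW.
- move=> t t0t; rewrite lte_fin => tb; have [tt2|/ltW t2t] := leP t t2.
    by rewrite wz //; apply: z_pos => //; rewrite lte_fin (le_lt_trans tt2).
  by rewrite wu //; split => //; have [] := Hu _ (u_itv _ t2t tb).
- move=> t t0t; rewrite lte_fin => tb; apply: is_derive_glue => // [tt2|t2t].
    by rewrite wz //; apply: dz => //; rewrite lte_fin (le_lt_trans tt2).
  by rewrite wu //; apply: is_derive_translate; have [] := Hu _ (u_itv _ t2t tb).
(* Since [t0 < t2], the glued function equals [z] just after [t0] and keeps its right derivative. *)
rewrite (wz _ (ltW t0t2)); apply: cvg_trans dz0; apply: near_eq_cvg.
near=> h; rewrite wz // -lerBrDl; near: h; apply: nbhs_right_le.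
by rewrite subr_gt0.
Unshelve. all: by end_near. Qed.
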